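(* Let $A\in M_N(\{0,1\})$ be primitive, with the notation of the context. Fix $\beta\in V_A\setminus\{\emptyset\}$ and a $\sigma$-invariant ergodic Borel probability measure $\tau$ on $\Omega_A$. For $n\in\mathbb N$ let $\pi_n:\Omega_A\to V_A^n$ be the map $x\mapsto x_1\cdots x_n$. Then for $\tau$-almost every $x\in C(\beta)$, $$\lim_{n\to\infty}\frac{\lambda^A_\beta(\pi_n(x))}{n}=\lambda_A\,\tau(F_A).$$ Moreover, there are constants $0<c_0\le c_1<1$, independent of $\tau$, such that $c_0\le\tau(F_A)\le c_1\lambda_A^{-1}$.
   Context: Let $A\in M_N(\{0,1\})$ be a primitive matrix. A word $x_1\cdots x_k$ over $\{1,\dots,N\}$ is admissible if $A_{x_n,x_{n+1}}=1$ for $1\le n\le k-1$; $V_A^k$ is the set of admissible words of length $k$ ($V_A^0=\{\emptyset\}$, $\emptyset$ the empty word), $V_A=\bigsqcup_k V_A^k$, $|\alpha|$ denotes length, and $\beta V_A$ denotes the set of admissible words beginning with $\beta$. $\Omega_A=\{x\in\{1,\dots,N\}^{\mathbb N}:A_{x_n,x_{n+1}}=1\ \forall n\}$ with the product topology and left shift $\sigma$; for $\alpha=\alpha_1\cdots\alpha_n$, $C(\alpha)=\{x\in\Omega_A:x_i=\alpha_i,\ i\le n\}$. Let $\lambda_A>1$ be the Perron–Frobenius eigenvalue of $A$ and $u$ the positive vector with $Au=\lambda_Au$, $\sum_iu_i=1$. Set $P_{i,j}=A_{i,j}u_j/(\lambda_Au_i)$ and $F_A:\Omega_A\to[0,1)$,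 $F_A(x)=u_{x_1}(1-P_{x_1,x_2})$. For $\beta\in V_A\setminus\{\emptyset\}$ and $\nu\in\beta V_A$ define $\lambda^A_\beta(\beta)=\lambda_Au_{\beta_{|\beta|}}$ and, for $\nu\ne\beta$, $$\lambda^A_\beta(\nu)=\lambda_Au_{\nu_{|\nu|}}+\lambda_A\sum_{k=0}^{|\nu|-|\beta|-1}u_{\nu_{|\beta|+k}}\bigl(1-P_{\nu_{|\beta|+k},\nu_{|\beta|+k+1}}\bigr).$$ (These are the nonzero eigenvalues of the log-Laplacian on the cylinder $C(\beta)$.) *)

(* Defs.v *)
From HB Require Import structures.
From mathcomp Require Import all_boot all_order all_algebra.
From mathcomp Require Import all_classical all_reals all_analysis.
Set Implicit Arguments. Unset Strict Implicit. Unset Printing Implicit Defensive.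
Import Order.TTheory GRing.Theory Num.Theory.
Local Open Scope classical_set_scope.
Local Open Scope ring_scope.

(* Alphabet {1,...,N} with N = n.+1, rendered as 'I_n.+1 = {0,...,n}, with
   the discrete topology. *)
Definition Sym (n : nat) : Type := discrete_topology 'I_n.+1.
HB.instance Definition _ n := Choice.on (Sym n).
HB.instance Definition _ n := Topological.on (Sym n).
HB.instance Definition _ n := isPointed.Build (Sym n) ord0.
Definition Seq (n : nat) : Type := prod_topology (fun _ : nat => Sym n).
HB.instance Definition _ n := Pointed.on (Seq n).
HB.instance Definition _ n := Nbhs.on (Seq n).
HB.instance Definition _ n := Topological.on (Seq n).
Definition BSeq (n : nat) := g_sigma_algebraType (@open (Seq n)).

Section SFT.
Variables (R : realType) (n : nat) (A : 'M[bool]_n.+1).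

Definition intmx : 'M[int]_n.+1 := map_mx (fun b : bool => (b%:R : int)) A.

Definition primitive : Prop :=
  exists k : nat, (0 < k)%N /\ forall i j, 0 < (intmx ^+ k) i j.

Definition admissible_word (w : seq 'I_n.+1) : Prop :=
  forall i : nat, (i.+1 < size w)%N -> A (nth ord0 w i) (nth ord0 w i.+1).

(* Omega_A, as a subset of the full sequence space (indices start at 0:
   x 0 is the paper's x_1). *)
Definition Omega : set (BSeq n) := [set x | forall m : nat, A (x m) (x m.+1)].

Definition shift (x : BSeq n) : BSeq n := fun m => x m.+1.

Definition cyl (w : seq 'I_n.+1) : set (BSeq n) :=
  Omega `&` [set x | forall i : nat, (i < size w)%N -> x i = nth ord0 w i].

Definition piw (k : nat) (x : BSeq n) : seq 'I_n.+1 := mkseq x k.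

Variables (lam : R) (u : 'I_n.+1 -> R).

Definition Pmat (i j : 'I_n.+1) : R := (A i j)%:R * u j / (lam * u i).

Definition FA (x : BSeq n) : R := u (x 0%N) * (1 - Pmat (x 0%N) (x 1%N)).

(* lambda^A_beta(nu) for nu in beta V_A (1-indexed letters of the paper are
   0-indexed here: nu_{|beta|+k} = nth ord0 nu (size beta - 1 + k)).
   When nu = beta the sum is empty and the value is lam * u_{beta_{|beta|}}. *)
Definition lambda_beta (beta nu : seq 'I_n.+1) : R :=
  lam * u (last ord0 nu) +
  lam * \sum_(k < size nu - size beta)
          u (nth ord0 nu (size beta - 1 + k)) *
          (1 - Pmat (nth ord0 nu (size beta - 1 + k)) (nth ord0 nu (size beta + k))).

End SFT.

Definition shift_invariant (R : realType) (n : nat)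
  (tau : probability (BSeq n) R) : Prop :=
  forall E : set (BSeq n), measurable E -> tau (@shift n @^-1` E) = tau E.

(* ergodicity of sigma on Omega_A: every Borel subset E of Omega_A with
   sigma^{-1}(E) = E (inside Omega_A) has measure 0 or 1. Borel subsets of
   Omega_A are exactly the traces E `&` Omega of Borel sets E. *)
Definition shift_ergodic (R : realType) (n : nat) (A : 'M[bool]_n.+1)
  (tau : probability (BSeq n) R) : Prop :=
  forall E : set (BSeq n), measurable E ->
    @shift n @^-1` E `&` Omega A = E `&` Omega A ->
    (tau (E `&` Omega A) = 0)%E \/ (tau (E `&` Omega A) = 1)%E.

(* Main.v *)
(* On [Omega A] one has F_A(x) = u_{x_1} - u_{x_2} / lam, and lam * u_i <= 1 since
   the entries of u sum to 1. Invariance of tau therefore gives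
   tau(F_A) = (1 - 1/lam) tau(u_{x_1}), which lies between
   (1 - 1/lam) min u and (1 - 1/lam) / lam. The eigenvalue at [piw k x] is
   lam times the k-th Birkhoff sum of F_A, up to a bounded error, so the limit is
   Birkhoff's theorem. For a bounded g the latter follows from Garsia's maximal
   inequality: the set where the Birkhoff sums of g are unbounded above is
   invariant, and if it had measure 1 the integral of g would be nonnegative;
   apply this to +-g minus a constant slightly above its integral. *)
Require Import Defs.
From HB Require Import structures.
From mathcomp Require Import all_boot all_order all_algebra.
From mathcomp Require Import all_classical all_reals all_analysis.
From mathcomp Require Import measurable_realfun.
From mathcomp Require Import ring lra.
Set Implicit Arguments. Unset Strict Implicit. Unset Printing Implicit Defensive.
Import Order.TTheory GRing.Theory Num.Theory.
Import numFieldNormedType.Exports.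
Local Open Scope classical_set_scope.
Local Open Scope ring_scope.

(** * Birkhoff's ergodic theorem for bounded functions *)

Section Birkhoff.
Context d (T : measurableType d) (R : realType) (P : probability T R).
Variable phi : T -> T.
Hypothesis mphi : measurable_fun [set: T] phi.
Hypothesis P_phi : forall E, measurable E -> P (phi @^-1` E) = P E.

Definition orbit_sum (g : T -> R) n x := \sum_(k < n) g (iter k phi x).

(* The maximum of [orbit_sum g k x] over [0 <= k <= n]. *)
Fixpoint orbit_max (g : T -> R) n x :=
  if n is m.+1 then Num.max 0 (g x + orbit_max g m (phi x)) else 0.

Lemma measurable_superlevel (g : T -> R) r : measurable_fun setT g ->
  measurable [set x | r < g x].
Proof.
move=> mg; rewrite (_ : mkset _ = setT `&` g @^-1` `]r, +oo[); first exact: mg.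
by rewrite setTI; apply/seteqP; split => x /=; rewrite in_itv/= andbT.
Qed.

Lemma orbit_sumS g n x : orbit_sum g n.+1 x = g x + orbit_sum g n (phi x).
Proof.
rewrite /orbit_sum big_ord_recl; congr (_ + _).
by apply: eq_bigr => i _; rewrite lift0 iterSr.
Qed.

Lemma orbit_sumSr g n x : orbit_sum g n.+1 x = orbit_sum g n x + g (iter n phi x).
Proof. by rewrite /orbit_sum big_ord_recr. Qed.

Lemma orbit_max_ge0 g n x : 0 <= orbit_max g n x.
Proof. by case: n => //= n; rewrite le_max lexx. Qed.

Lemma orbit_max_leS g n x : orbit_max g n x <= orbit_max g n.+1 x.
Proof.
elim: n x => [|n IH] x; first exact: orbit_max_ge0.
by rewrite /= ge_max !le_max lexx /= lerD2l IH orbT.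
Qed.

Lemma orbit_sum_le_max g n x : orbit_sum g n x <= orbit_max g n x.
Proof.
elim: n x => [|n IH] x; first by rewrite /orbit_sum big_ord0.
by rewrite orbit_sumS /= le_max lerD2l IH orbT.
Qed.

Lemma orbit_max_le g C n x : 0 <= C -> (forall x, g x <= C) ->
  orbit_max g n x <= C *+ n.
Proof.
move=> C0 gC; elim: n x => [|n IH] x //=.
by rewrite ge_max mulrn_wge0//= mulrS lerD.
Qed.

Lemma measurable_orbit_sum g n : measurable_fun setT g ->
  measurable_fun setT (orbit_sum g n).
Proof.
move=> mg; elim: n => [|n IH].
  rewrite (_ : orbit_sum g 0 = cst 0)//.
  by apply/funext => x; rewrite /orbit_sum big_ord0.
rewrite (_ : orbit_sum g n.+1 = g \+ (orbit_sum g n \o phi)).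
  by apply: measurable_funD => //; exact: measurableT_comp.
by apply/funext => x; rewrite orbit_sumS.
Qed.

Lemma measurable_orbit_max g n : measurable_fun setT g ->
  measurable_fun setT (orbit_max g n).
Proof.
move=> mg; elim: n => [|n IH] //=.
apply: measurable_maxr => //.
by apply: measurable_funD => //; exact: measurableT_comp.
Qed.

Lemma bounded_integrable (g : T -> R) C : measurable_fun setT g ->
  (forall x, `|g x| <= C) -> P.-integrable setT (EFin \o g).
Proof.
move=> mg gC; apply: measurable_bounded_integrable => //.
  exact: (le_lt_trans (probability_le1 P measurableT) (ltry 1)).
by exists C; split; [exact: num_real|move=> y /ltW Cy x _ /=; exact: le_trans (gC x) Cy].
Qed.

Lemma RintegralT_cst (r : R) : \int[P]_(_ in setT) r = r.
Proof.
rewrite Rintegral_cst//.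
have -> : fine (P setT) = 1 by rewrite probability_setT.
by rewrite mulr1.
Qed.

(** Change of variables: by invariance, the pushforward of [P] under [phi] agrees with [P] on
    measurable sets. *)
Lemma Rintegral_comp (g : T -> R) C : measurable_fun setT g ->
  (forall x, `|g x| <= C) ->
  (\int[P]_x g (phi x) = \int[P]_x g x)%R.
Proof.
move=> mg gC; rewrite /Rintegral; congr fine.
rewrite -[RHS](@eq_measure_integral _ _ _ setT P (pushforward P phi)).
  rewrite integral_pushforward ?preimage_setT//.
    exact/measurable_EFinP.
  apply: (@bounded_integrable (g \o phi) C) => [|x]; last exact: gC.
  exact: measurableT_comp.
by move=> A mA _; exact: P_phi.
Qed.

(** Garsia's argument: integrate a pointwise lower bound for [g + M \o phi - M], where [M] is
    [orbit_max g n], then let [n] grow. *)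
Lemma maximal_ergodic (g : T -> R) C : measurable_fun setT g ->
  (forall x, `|g x| <= C) ->
  P [set x | exists n, 0 < orbit_sum g n x] = 1%E ->
  0 <= \int[P]_x g x.
Proof.
move=> mg gC P1.
have C0 : 0 <= C by exact: le_trans (normr_ge0 _) (gC point).
pose E n := [set x | 0 < orbit_max g n x].
have mE n : measurable (E n).
  by apply: measurable_superlevel; exact: measurable_orbit_max.
have ndE : nondecreasing_seq E.
  apply/nondecreasing_seqP => n; rewrite subsetEset => x /=.
  by move=> /lt_le_trans; apply; exact: orbit_max_leS.
have mUE : measurable (\bigcup_n E n) by exact: bigcupT_measurable.
have PE : P (\bigcup_n E n) = 1%E.
  apply/eqP; rewrite eq_le probability_le1//= -P1 le_measure ?inE//.
    rewrite (_ : mkset _ = \bigcup_n [set x | 0 < orbit_sum g n x]).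
      apply: bigcupT_measurable => n; apply: measurable_superlevel.
      exact: measurable_orbit_sum.
    by apply/seteqP; split=> x /= [k]; [exists k|move=> _; exists k].
  move=> x [k /lt_le_trans kx]; exists k => //; apply: kx.
  exact: orbit_sum_le_max.
(* [M_n <= g + M_n o phi] on [E n], while [M_n = 0] off [E n]. *)
have key n : C * (fine (P (E n)) - 1) <= \int[P]_x g x.
  pose M := orbit_max g n.
  have mM : measurable_fun setT M by exact: measurable_orbit_max.
  have bM x : `|M x| <= C *+ n.
    rewrite ger0_norm ?orbit_max_ge0//; apply: orbit_max_le => // y.
    exact: le_trans (ler_norm _) (gC y).
  have iM := bounded_integrable mM bM.
  have iMphi : P.-integrable setT (EFin \o (M \o phi)).
    apply: (@bounded_integrable _ (C *+ n)) => [|x]; last exact: bM.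
    exact: measurableT_comp.
  have ig := bounded_integrable mg gC.
  have igM : P.-integrable setT (EFin \o (fun x => g x + M (phi x))).
    exact: (integrableD measurableT ig iMphi).
  (* By invariance [M \o phi] and [M] have the same integral, so their difference may be added
     freely. *)
  have <- : \int[P]_x (g x + M (phi x) - M x) = \int[P]_x g x.
    by rewrite RintegralB// RintegralD//= (Rintegral_comp mM bM) addrK.
  have i1 : P.-integrable setT (EFin \o (\1_(E n) : T -> R)).
    exact: integrable_indic.
  have ic (r : R) : P.-integrable setT (EFin \o (fun=> r)).
    by apply: (@bounded_integrable _ `|r|).
  have i2 : P.-integrable setT (EFin \o (fun x => \1_(E n) x - 1 : R)).
    exact: (integrableB measurableT i1 (ic 1)).
  have -> : C * (fine (P (E n)) - 1) = \int[P]_x (C * (\1_(E n) x - 1)).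
    rewrite RintegralZl// RintegralB//.
    rewrite RintegralT_cst.
    by rewrite /Rintegral integral_indic// setIT.
  apply: le_Rintegral => //.
  - exact: (integrableZl measurableT C i2).
  - exact: (integrableB measurableT igM iM).
  - move=> x _; rewrite indicE; case: (boolP (x \in E n)) => xE.
      rewrite subrr mulr0 subr_ge0.
      have := orbit_max_leS g n x; rewrite /= le_max => /orP[|//].
      by move: xE; rewrite inE /E /= ltNge => /negP.
    have -> : M x = 0.
      apply/le_anti; rewrite orbit_max_ge0 andbT leNgt.
      by apply: contra xE => Mx; rewrite inE.
    (* Off [E n] the bound is just [- C <= g x]; the total loss is [C] times the measure of the
       complement of [E n]. *)
    rewrite subr0 sub0r mulrN1; apply: (@le_trans _ _ (g x)).
      by move: (gC x); rewrite ler_norml => /andP[].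
    by rewrite lerDl orbit_max_ge0.
(* The sets [E n] increase to a set of measure 1, so the lower bound in [key] tends to 0. *)
have := @nondecreasing_cvg_mu _ _ _ P E mE mUE ndE.
rewrite [X in _ --> X -> _]PE => /fine_cvg cvE.
have : (fun n => C * (fine (P (E n)) - 1)) @ \oo --> C * (1 - 1 : R).
  by apply: cvgMr; apply: cvgB => //; exact: cvg_cst.
rewrite subrr mulr0 => cv.
rewrite -(cvg_lim _ cv)//; apply: limr_le => //; first by apply/cvg_ex; eexists; exact: cv.
by near=> n; exact: key.
Unshelve. all: by end_near. Qed.

Hypothesis P_ergodic : forall E, measurable E -> phi @^-1` E = E ->
  P E = 0%E \/ P E = 1%E.

(** The orbit sums at [x] and at [phi x] differ by [g x], of size at most [C], so unboundedness
    above is an invariant property. By ergodicity it has measure 0 or 1, and the maximal inequality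
    excludes 1. *)
Lemma ae_orbit_sum_bounded (g : T -> R) C : measurable_fun setT g ->
  (forall x, `|g x| <= C) -> \int[P]_x g x < 0 ->
  {ae P, forall x, exists M, forall n, orbit_sum g n x <= M}.
Proof.
move=> mg gC g_lt0.
pose B := \bigcap_(m : nat) \bigcup_n [set x | m%:R < orbit_sum g n x].
have mB : measurable B.
  apply: bigcapT_measurable => m; apply: bigcupT_measurable => n.
  by apply: measurable_superlevel; exact: measurable_orbit_sum.
have invB : phi @^-1` B = B.
  apply/seteqP; split=> x Bx m _.
    (* The chosen natural number exceeds [m%:R + C], which leaves room for gaining or losing the
       term [g x]. *)
    have [n _ /= Hn] := Bx (Num.truncn (m%:R + C)).+1 I.
    exists n.+1 => //=; rewrite orbit_sumS.
    have gx : - C <= g x by move: (gC x); rewrite ler_norml => /andP[].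
    have := lt_trans (truncnS_gt (m%:R + C)) Hn.
    by lra.
  have [n _ /= Hn] := Bx (Num.truncn (m%:R + C)).+1 I.
  have C0 : 0 <= C by exact: le_trans (normr_ge0 _) (gC x).
  (* The empty sum is 0 and exceeds no natural number, so a first term can be split off. *)
  case: n Hn => [|n]; first by rewrite /orbit_sum big_ord0 ltNge ler0n.
  rewrite orbit_sumS => Hn; exists n => //=.
  have gx : g x <= C by exact: le_trans (ler_norm _) (gC x).
  have := lt_trans (truncnS_gt (m%:R + C)) Hn.
  by lra.
have PB : P B = 0%E.
  have [//|PB1] := P_ergodic mB invB.
  have : 0 <= \int[P]_x g x.
    apply: (maximal_ergodic mg gC); apply/eqP.
    have mS : measurable [set x | exists n, 0 < orbit_sum g n x].
      rewrite (_ : mkset _ = \bigcup_n [set x | 0 < orbit_sum g n x]).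
        apply: bigcupT_measurable => n; apply: measurable_superlevel.
        exact: measurable_orbit_sum.
      by apply/seteqP; split=> x /= [k]; [exists k|move=> _; exists k].
    rewrite eq_le probability_le1//= -PB1 le_measure ?inE//.
    by move=> x /(_ 0%N I)[n _ /= ?]; exists n.
  by rewrite leNgt g_lt0.
exists B; split => // x /= unbdd m _.
apply: contrapT => bdd; apply: unbdd; exists m%:R => n.
by rewrite leNgt; apply/negP => lt_m; apply: bdd; exists n.
Qed.

Lemma orbit_sumB_cst g c n x :
  orbit_sum (fun x => g x - c) n x = orbit_sum g n x - n%:R * c.
Proof.
by rewrite /orbit_sum sumrB sumr_const card_ord mulr_natl.
Qed.

(** The function [g - a] has negative integral, so its orbit sums are almost everywhere bounded
    above. *)
Lemma ae_orbit_sum_le (g : T -> R) C a : measurable_fun setT g ->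
  (forall x, `|g x| <= C) -> \int[P]_x g x < a ->
  {ae P, forall x, exists M, forall n, orbit_sum g n x <= n%:R * a + M}.
Proof.
move=> mg gC ga.
have bcst : forall x : T, `|cst a x| <= `|a| by [].
have : {ae P, forall x, exists M, forall n,
    orbit_sum (fun x => g x - a) n x <= M}; last first.
  apply: filterS => x [M HM]; exists M => n.
  by move: (HM n); rewrite orbit_sumB_cst lerBlDl.
apply: (@ae_orbit_sum_bounded _ (C + `|a|)).
- exact: measurable_funB.
- by move=> x; rewrite (le_trans (ler_normB _ _))// lerD.
- rewrite RintegralB//; last exact: (bounded_integrable _ bcst).
    by rewrite RintegralT_cst subr_lt0.
  exact: (bounded_integrable mg gC).
Qed.

Lemma birkhoff_bounded (g : T -> R) C : measurable_fun setT g ->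
  (forall x, `|g x| <= C) ->
  {ae P, forall x, orbit_sum g n x / n%:R @[n --> \oo] --> \int[P]_x g x}.
Proof.
move=> mg gC; set m := \int[P]_x g x.
have mN : measurable_fun setT (\- g) by exact: measurable_funN.
have bN x : `|(\- g) x| <= C by rewrite normrN.
have intN : \int[P]_x (\- g) x = - m.
  rewrite -mulN1r -RintegralZl//; last exact: (bounded_integrable mg gC).
  by apply: eq_Rintegral => x _; rewrite mulN1r.
(* There are countably many slacks [j.+1%:R^-1], so one null set serves them all. *)
have up : {ae P, forall x, forall j : nat, exists M, forall n,
    orbit_sum g n x <= n%:R * (m + j.+1%:R^-1) + M}.
  apply: ae_foralln => j; apply: (ae_orbit_sum_le mg gC).
  by rewrite ltrDl invr_gt0.
have dn : {ae P, forall x, forall j : nat, exists M, forall n,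
    orbit_sum (\- g) n x <= n%:R * (- m + j.+1%:R^-1) + M}.
  apply: ae_foralln => j; apply: (ae_orbit_sum_le mN bN).
  by rewrite intN ltrDl invr_gt0.
apply: filterS2 up dn => x up dn.
apply/cvgrPdist_le => e e0.
have e20 : 0 < e / 2 by rewrite divr_gt0.
pose j := Num.truncn (e / 2)^-1.
have je : j.+1%:R^-1 <= e / 2.
  by rewrite -[leRHS]invrK lef_pV2 ?posrE ?invr_gt0// ltW// truncnS_gt.
have [M1 H1] := up j; have [M2 H2] := dn j.
near=> n.
have n0 : 0 < n%:R :> R by rewrite ltr0n; near: n; exact: nbhs_infty_gt.
(* [M1] and [M2] depend on [x] and [j] but not on [n], so half of the error [n%:R * e] absorbs each
   of them for large [n]. *)
have nM1 : M1 <= n%:R * (e / 2).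
  by rewrite -ler_pdivrMr//; near: n; exact: nbhs_infty_ger.
have nM2 : M2 <= n%:R * (e / 2).
  by rewrite -ler_pdivrMr//; near: n; exact: nbhs_infty_ger.
have nj : n%:R * j.+1%:R^-1 <= n%:R * (e / 2) by rewrite ler_pM2l.
have SN : orbit_sum (\- g) n x = - orbit_sum g n x.
  by rewrite /orbit_sum sumrN.
move: (H1 n) (H2 n); rewrite SN !mulrDr => {}H1 {}H2.
have aux (s t v w M : R) : s <= t + v + M -> v <= w -> M <= w -> s <= t + (w + w).
  by lra.
have {}H1 := aux _ _ _ _ _ H1 nj nM1; have {}H2 := aux _ _ _ _ _ H2 nj nM2.
rewrite -mulrDr -splitr in H1 H2.
rewrite distrC ler_norml lerBlDr lerBrDr; apply/andP; split.
  by rewrite ler_pdivlMr//; lra.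
by rewrite ler_pdivrMr//; lra.
Unshelve. all: by end_near. Qed.
End Birkhoff.

(** * Continuity and measurability on the sequence space *)

Section Shift.
Variable n : nat.

Lemma open_coord (i : nat) (B : set 'I_n.+1) :
  open ([set x | B (x i)] : set (Seq n)).
Proof.
pose K := fun _ : nat => (Sym n : topologicalType).
have /(proj1 (continuousP (@proj nat K i : prod_topology K -> K i))) :=
  @proj_continuous nat K i.
by apply; exact: discrete_open.
Qed.

(** The product topology is a supremum of initial topologies, so continuity is tested on
    coordinates; coordinate [i] of the shift is coordinate [i.+1] of the point. *)
Lemma continuous_seq_shift : continuous (@Defs.shift n : Seq n -> Seq n).
Proof.
move=> x.
apply: (proj2 (@cvg_sup _ _ _ (@Defs.shift n @ nbhs x) (@Defs.shift n x) _)) => i U.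
have /= -> := @nbhsE (initial_topology (fun f : forall _ : nat, Sym n => f i))
  (@Defs.shift n x).
case=> B [[C oC <- Cx]] /filterS; apply.
by apply: open_nbhs_nbhs; split => //; exact: (open_coord i.+1 C).
Qed.

Lemma measurable_seq_shift : measurable_fun setT (@Defs.shift n).
Proof.
apply: (@measurability _ _ (BSeq n) (BSeq n) _ _ (@open (Seq n))) => // _ [B oB <-].
rewrite setTI; apply: sub_sigma_algebra.
by move/continuousP : continuous_seq_shift; apply.
Qed.

Lemma measurable_coord (i : nat) (B : set 'I_n.+1) :
  measurable ([set x | B (x i)] : set (BSeq n)).
Proof. by apply: sub_sigma_algebra; exact: open_coord. Qed.

Lemma iter_seq_shift (k : nat) (x : BSeq n) m : iter k (@Defs.shift n) x m = x (k + m)%N.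
Proof. by elim: k m => [|k IH] m //=; rewrite /Defs.shift IH addnS addSn. Qed.

Lemma measurable_Omega (A : 'M[bool]_n.+1) : measurable (Omega A).
Proof.
(* Splitting on the finitely many values of [x m] turns a condition on two coordinates into
   conditions on single ones. *)
rewrite (_ : Omega A = \bigcap_m \bigcup_(i in [set: 'I_n.+1])
    ([set x | x m = i] `&` [set x | A i (x m.+1)])).
  apply: bigcapT_measurable => m.
  apply: fin_bigcup_measurable => // i _.
  apply: measurableI; first exact: (measurable_coord m [set i]).
  exact: (measurable_coord m.+1 [set j | A i j]).
apply/seteqP; split=> [x Ax m _|x Ax m]; first by exists (x m) => //; split=> //; exact: Ax.
by have [i _ [/= ->]] := Ax m I.
Qed.

End Shift.

(** * The Perron-Frobenius vector, the function [FA] and the eigenvalues *)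

Section LogLaplacian.
Variables (R : realType) (n : nat) (A : 'M[bool]_n.+1) (lam : R).
Variable u : 'I_n.+1 -> R.
Hypothesis u_pos : forall i, 0 < u i.
Hypothesis u_eig : forall i, \sum_j (A i j)%:R * u j = lam * u i.
Hypothesis u_sum : \sum_i u i = 1.
Hypothesis lam_gt1 : 1 < lam.

Lemma lam_gt0 : 0 < lam. Proof. exact: lt_trans lam_gt1. Qed.

(** By the eigenvector equation, [lam * u i] is the sum of some of the entries of [u], which are
    positive with total 1. *)
Lemma lam_u_le1 i : lam * u i <= 1.
Proof.
rewrite -u_eig -[leRHS]u_sum; apply: ler_sum => j _.
by case: (A i j); [rewrite mul1r|rewrite mul0r ltW].
Qed.

Lemma u_le1 i : u i <= 1.
Proof.
by apply: le_trans (lam_u_le1 i); rewrite ler_peMl// ltW.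
Qed.

(* Agrees with [FA] on [Omega A] only. *)
Definition FA_full (x : BSeq n) : R := u (x 0%N) - u (x 1%N) / lam.

Lemma FAE (x : BSeq n) : A (x 0%N) (x 1%N) ->
  FA A lam u x = FA_full x.
Proof.
move=> Ax; rewrite /FA /Pmat /FA_full Ax mul1r.
have := u_pos (x 0%N); have := lam_gt0; set a := u _; set b := u _ => l0 a0.
by field; rewrite !gt_eqF.
Qed.

Lemma measurable_ucoord i : measurable_fun setT (fun x : BSeq n => u (x i)).
Proof.
by move=> _ B mB; rewrite setTI; exact: (measurable_coord i [set j | B (u j)]).
Qed.

Lemma measurable_FA_full : measurable_fun setT FA_full.
Proof.
apply: measurable_funB; first exact: measurable_ucoord.
by apply: measurable_funM => //; exact: measurable_ucoord.
Qed.

Lemma ucoord_bounded (i : nat) (x : BSeq n) : `|u (x i)| <= 1.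
Proof. by rewrite gtr0_norm ?u_pos// u_le1. Qed.

Lemma ucoord_lam_bounded (i : nat) (x : BSeq n) : `|u (x i) / lam| <= 1.
Proof.
rewrite normrM (gtr0_norm (u_pos _)) gtr0_norm ?invr_gt0 ?lam_gt0//.
by rewrite ler_pdivrMr ?lam_gt0// mul1r (le_trans (u_le1 _))// ltW.
Qed.

Lemma FA_full_bounded x : `|FA_full x| <= 1 + 1.
Proof.
rewrite (le_trans (ler_normB _ _))// lerD//.
  exact: ucoord_bounded.
exact: ucoord_lam_bounded.
Qed.

(** * Integrals against an invariant probability carried by [Omega A] *)

Section Invariant.
Variable tau : probability (BSeq n) R.
Hypothesis tau_Omega : tau (Omega A) = 1%E.
Hypothesis tau_inv : shift_invariant tau.

(** The complement of [Omega A] is null, so the integral may be taken over the whole space once [FA]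
    is replaced by [FA_full]. *)
Lemma integral_FA : (\int[tau]_(x in Omega A) (FA A lam u x)%:E =
  (\int[tau]_x FA_full x)%:E)%E.
Proof.
have iF := bounded_integrable tau measurable_FA_full FA_full_bounded.
have mO := measurable_Omega A.
rewrite /Rintegral fineK; last exact: integrable_fin_num.
rewrite [RHS](@negligible_integral _ _ _ _ _ (~` Omega A))//.
- rewrite setTD setCK; apply: eq_integral => x; rewrite inE => Ox.
  by rewrite FAE//; exact: Ox.
- exact: measurableC.
- by have := probability_setC tau mO; rewrite tau_Omega subee// => ->.
Qed.

Lemma Rintegral_FA_full :
  \int[tau]_x FA_full x = (1 - lam^-1) * \int[tau]_x u (x 0%N).
Proof.
have i0 := bounded_integrable tau (measurable_ucoord 0) (@ucoord_bounded 0).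
have i1 := bounded_integrable tau (measurable_ucoord 1) (@ucoord_bounded 1).
rewrite RintegralB//; last first.
  apply: (@bounded_integrable _ _ _ _ _ 1) => [|x]; last exact: ucoord_lam_bounded.
  by apply: measurable_funM => //; exact: measurable_ucoord.
rewrite RintegralZr//.
have -> : \int[tau]_x u (x 1%N) = \int[tau]_x u (x 0%N).
  exact: (Rintegral_comp (@measurable_seq_shift n) tau_inv (measurable_ucoord 0)
    (@ucoord_bounded 0)).
by rewrite mulrBl mul1r mulrC.
Qed.

Lemma le_Rintegral_ucoord c : (forall i, c <= u i) ->
  c <= \int[tau]_x u (x 0%N).
Proof.
move=> cu; rewrite -[leLHS](RintegralT_cst tau); apply: le_Rintegral => //.
  exact: (@bounded_integrable _ _ _ tau (cst c) `|c|).
exact: bounded_integrable (measurable_ucoord 0) (@ucoord_bounded 0).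
Qed.

Lemma Rintegral_ucoord_le c : (forall i, u i <= c) ->
  \int[tau]_x u (x 0%N) <= c.
Proof.
move=> cu; rewrite -[leRHS](RintegralT_cst tau); apply: le_Rintegral => //.
  exact: bounded_integrable (measurable_ucoord 0) (@ucoord_bounded 0).
exact: (@bounded_integrable _ _ _ tau (cst c) `|c|).
Qed.

(** Passes from ergodicity of traces on [Omega A] to ergodicity on the full space, as Birkhoff's
    theorem requires: intersecting with a set of full measure keeps the measure. *)
Lemma shift_ergodic_setT : shift_ergodic A tau ->
  forall E, measurable E -> @Defs.shift n @^-1` E = E -> tau E = 0%E \/ tau E = 1%E.
Proof.
move=> erg E mE EE.
have mO := measurable_Omega A.
suff <- : tau (E `&` Omega A) = tau E by apply: erg => //; rewrite EE.
have O0 : tau (~` Omega A) = 0%E.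
  by have := probability_setC tau mO; rewrite tau_Omega subee// => ->.
rewrite -[in RHS](setIT E) -(setUv (Omega A)) setIUr measureU//.
- rewrite [X in (_ + X)%E](_ : _ = 0%E) ?adde0//.
  apply: subset_measure0 O0 => //.
  + by apply: measurableI => //; exact: measurableC.
  + exact: measurableC.
- exact: measurableI.
- by apply: measurableI => //; exact: measurableC.
- by rewrite setIACA setICr setI0.
Qed.

End Invariant.

(** The sum in [lambda_beta] covers the orbit positions from [size beta - 1] to [k - 2]. The
    last-letter term supplies position [k - 1], since [lam * u (x k.-1)] is [lam] times [FA_full]
    there plus [u (x k)]. *)
Lemma lambda_beta_orbit_sum (beta : seq 'I_n.+1) (x : BSeq n) (k : nat) :
  beta != [::] -> (size beta <= k)%N -> Omega A x ->
  lambda_beta A lam u beta (piw k x) =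
  lam * orbit_sum (@Defs.shift n) FA_full k x +
  (u (x k) - lam * orbit_sum (@Defs.shift n) FA_full (size beta).-1 x).
Proof.
move=> b0 bk Ox; set S := orbit_sum _ _; rewrite /lambda_beta /piw size_mkseq.
(* As [beta] is nonempty, the truncated subtraction [size beta - 1] is a true one, with value
   [b]. *)
have [b bE] : exists b, size beta = b.+1.
  by case: (beta) b0 => // a s _; exists (size s).
rewrite bE subn1 !succnK in bk *.
have [m ->] : exists m, k = (b + m).+1 by exists (k - b.+1)%N; rewrite -addSn subnKC.
rewrite subSS addKn -nth_last size_mkseq succnK nth_mkseq//.
under eq_bigr => j _.
  rewrite nth_mkseq; last by rewrite ltnS leq_add2l ltnW.
  rewrite addSn nth_mkseq; last by rewrite ltnS ltn_add2l.
  rewrite (_ : u _ * _ = FA_full (iter (b + j) (@Defs.shift n) x)); last first.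
    rewrite /FA_full !iter_seq_shift addn0 addn1.
    have := @FAE (iter (b + j) (@Defs.shift n) x).
    rewrite /FA /FA_full !iter_seq_shift addn0 addn1; apply.
    exact: Ox.
  over.
have -> : \sum_(j < m) FA_full (iter (b + j) (@Defs.shift n) x) =
    S (b + m)%N x - S b x.
  by rewrite /S /orbit_sum big_split_ord/= [RHS]addrC addKr.
have -> : S (b + m).+1 x =
    S (b + m)%N x + FA_full (iter (b + m) (@Defs.shift n) x).
  exact: orbit_sumSr.
rewrite /FA_full !iter_seq_shift addn0 addn1.
by have := lam_gt0 => l0; field; rewrite gt_eqF.
Qed.

Lemma cvg_lambda_beta (beta : seq 'I_n.+1) (x : BSeq n) (l : R) :
  beta != [::] -> Omega A x ->
  orbit_sum (@Defs.shift n) FA_full k x / k%:R @[k --> \oo] --> l ->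
  lambda_beta A lam u beta (piw k x) / k%:R @[k --> \oo] --> lam * l.
Proof.
move=> b0 Ox cvl.
set s := lam * orbit_sum (@Defs.shift n) FA_full (size beta).-1 x.
have inv0 : k%:R^-1 @[k --> \oo] --> (0 : R).
  by rewrite -(@cvg_shiftS R^o); exact: cvg_harmonic.
(* The numerator stays in [[0, 1]], so the quotient is squeezed by [k%:R^-1]. *)
have cvu : u (x k) / k%:R @[k --> \oo] --> (0 : R).
  apply: (@squeeze_cvgr _ _ _ _ (cst 0) (fun k => k%:R^-1)) => //.
    apply: nearW => k /=; apply/andP; split.
      by rewrite divr_ge0// ltW.
    by rewrite ler_piMl ?u_le1// invr_ge0.
  exact: cvg_cst.
have cv : (lam * (orbit_sum (@Defs.shift n) FA_full k x / k%:R) +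
    (u (x k) / k%:R - s * k%:R^-1)) @[k --> \oo] --> lam * l + (0 - s * 0).
  apply: cvgD; first exact: cvgMr.
  by apply: cvgB => //; exact: cvgMr.
rewrite mulr0 subrr addr0 in cv.
(* The orbit-sum formula holds only once [size beta <= k], hence the passage to eventual
   equality. *)
apply: cvg_trans cv; apply: near_eq_cvg; near=> k.
rewrite lambda_beta_orbit_sum//; last by near: k; exact: nbhs_infty_ge.
by rewrite mulrDl mulrBl mulrA.
Unshelve. all: by end_near. Qed.

End LogLaplacian.

Theorem theorem3p1 (R : realType) (n : nat) (A : 'M[bool]_n.+1)
  (hA : primitive A) (lam : R) (u : 'I_n.+1 -> R)
  (hu_pos : forall i, 0 < u i)
  (hu_eig : forall i, \sum_j (A i j)%:R * u j = lam * u i)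
  (hu_sum : \sum_i u i = 1)
  (hlam : 1 < lam) :
  exists c0 c1 : R, [/\ 0 < c0, c0 <= c1, c1 < 1 &
    forall (beta : seq 'I_n.+1), beta != [::] -> admissible_word A beta ->
    forall tau : probability (BSeq n) R,
      tau (Omega A) = 1%E -> shift_invariant tau -> shift_ergodic A tau ->
      [/\ (c0%:E <= \int[tau]_(x in Omega A) (FA A lam u x)%:E)%E,
          (\int[tau]_(x in Omega A) (FA A lam u x)%:E <= (c1 / lam)%:E)%E &
          {ae tau, forall x, cyl A beta x ->
             (fun k : nat => (lambda_beta A lam u beta (piw k x) / k%:R)%:E)
               @ \oo --> (lam%:E * \int[tau]_(x in Omega A) (FA A lam u x)%:E)%E}]].
Proof.
have l0 := lam_gt0 hlam.
have ul1 := u_le1 hu_pos hu_eig hu_sum hlam.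
have d0 : 0 < 1 - lam^-1 by rewrite subr_gt0 invf_lt1.
pose i0 := [arg min_(i < ord0 : 'I_n.+1) u i]%O.
have i0P i : u i0 <= u i by rewrite /i0; case: arg_minP => // j _; apply.
(* These multiply [1 - lam^-1] by the least entry of [u] and by 1. The upper bound [c1 / lam] will
   come from [u i <= 1 / lam]. *)
exists ((1 - lam^-1) * u i0), (1 - lam^-1); split.
- by rewrite mulr_gt0.
- by rewrite ler_piMr// ltW.
- by rewrite ltrBlDr ltrDl invr_gt0.
move=> beta b0 _ tau tO tinv terg.
have intE := integral_FA hu_pos hu_eig hu_sum hlam tO.
rewrite intE; split.
- rewrite lee_fin (Rintegral_FA_full hu_pos hu_eig hu_sum hlam tinv).
  rewrite ler_pM2l//.
  exact: (le_Rintegral_ucoord hu_pos hu_eig hu_sum hlam).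
- rewrite lee_fin (Rintegral_FA_full hu_pos hu_eig hu_sum hlam tinv).
  rewrite ler_pM2l//.
  apply: (Rintegral_ucoord_le hu_pos hu_eig hu_sum hlam) => i.
  by rewrite -[leRHS]mul1r ler_pdivlMr// mulrC (lam_u_le1 hu_pos hu_eig hu_sum).
- have := birkhoff_bounded (@measurable_seq_shift n) tinv
    (shift_ergodic_setT tO terg) (measurable_FA_full lam u)
    (FA_full_bounded hu_pos hu_eig hu_sum hlam).
  apply: filterS => x cvx [Ox _].
  rewrite -EFinM; apply: cvg_EFin; first exact: nearW.
  exact: (cvg_lambda_beta hu_pos hu_eig hu_sum hlam b0 Ox cvx).
Qed.
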